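(* Let $(R,\mathfrak m)$ be a Noetherian local ring and let $M$ be a finitely generated $R$-module. Suppose that $N$ is a strongly irreducible submodule of $M$ such that $\mathfrak mM\neq N$ and $\operatorname{Rad}(N:_RM)=\mathfrak m$. Then $N$ and $N:_M\mathfrak m$ are comparable by set inclusion to all submodules of $M$. In fact, $$N=\bigcup\{K : K \text{ is a submodule of } M \text{ and } K\subsetneqq N:_M\mathfrak m\},$$ and $$N:_M\mathfrak m=\bigcap\{L : L \text{ is a submodule of } M \text{ and } N\subsetneqq L\}.$$
   Context: All rings are commutative with non-zero identity. A submodule $N$ of $M$ is strongly irreducible if for all submodules $K,L$ of $M$, $K\cap L\subseteq N$ implies $K\subseteq N$ or $L\subseteq N$. $N:_RM=\{r\in R: rM\subseteq N\}$, $\operatorname{Rad}$ denotes the radical of an ideal, and $N:_M\mathfrak m=\{x\in M:\mathfrak mx\subseteq N\}$. *)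

(* Defs.v *)
From mathcomp Require Import all_boot all_algebra.
From mathcomp Require Import boolp classical_sets cardinality.

Set Implicit Arguments.
Unset Strict Implicit.
Unset Printing Implicit Defensive.

Import GRing.Theory.

Local Open Scope ring_scope.
Local Open Scope classical_set_scope.

(* Submodules and ideals are Prop-valued sets, so that quantifying over them
   is not restricted to decidable ones. *)

Section Submodule.
Variables (R : comNzRingType) (M : lmodType R).
Implicit Types (N K L : set M) (I : set R).

Definition submodule N : Prop := submod_closed [in N].

Definition submod_span (S : set M) : set M := smallest submodule S.

Definition finitely_generated N : Prop :=
  exists2 S : set M, finite_set S & N = submod_span S.

(* I N *)
Definition ideal_submod_mul I N : set M :=
  submod_span [set a *: x | a in I & x in N].

(* N :_R M *)
Definition ring_colon N : set R :=
  [set r | [set r *: x | x in [set: M]] `<=` N].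

(* N :_M I *)
Definition module_colon N I : set M :=
  [set x | [set a *: x | a in I] `<=` N].

(* Meant for N a submodule; properness is not required. *)
Definition strongly_irreducible N : Prop :=
  forall K L, submodule K -> submodule L ->
    K `&` L `<=` N -> K `<=` N \/ L `<=` N.

Definition set_comparable N K : Prop := N `<=` K \/ K `<=` N.

End Submodule.

Section Ideal.
Variable R : comNzRingType.
Implicit Types I J m : set R.

(* R^o is R as a module over itself.  The unit ideal is allowed, unlike in
   mathcomp's idealr_closed. *)
Definition ideal I : Prop := submodule (I : set R^o).

Definition radical I : set R := [set r | exists2 n, (0 < n)%N & I (r ^+ n)].

Definition maximal_ideal m : Prop :=
  [/\ ideal m, m <> [set: R]
    & forall J, ideal J -> m `<=` J -> J = m \/ J = [set: R]].

(* R is local with maximal ideal m *)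
Definition local_ring m : Prop :=
  maximal_ideal m /\ forall m', maximal_ideal m' -> m' = m.

End Ideal.

Definition noetherian_ring (R : comNzRingType) : Prop :=
  forall I : set R, ideal I -> finitely_generated (I : set R^o).

(* Main.v *)
Require Import Defs.
From mathcomp Require Import all_boot all_algebra.
From mathcomp Require Import boolp classical_sets cardinality.

Set Implicit Arguments.
Unset Strict Implicit.
Unset Printing Implicit Defensive.

Import GRing.Theory.

Local Open Scope ring_scope.
Local Open Scope classical_set_scope.

(** Put S = N :_M m.  If x and y lie in S but not in N, strong irreducibility
    gives a x = b y outside N; as m kills S modulo N, both a and b are units, so
    Rx = Ry.  Replacing y by x + n with n in N shows that N is contained in Rx,
    and hence every element of S outside N generates S.  On the other hand, m
    is finitely generated and acts nilpotently on M / N, so any submodule that is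
    not contained in N meets S outside N, and therefore contains S. *)

Section Submodules.
Variables (R : comNzRingType) (M : lmodType R).
Implicit Types (N K : set M) (I : set R).

Lemma submoduleP N :
  submodule N <-> N 0 /\ forall a x y, N x -> N y -> N (a *: x + y).
Proof.
split=> -[N0 NL]; split.
- by move: N0; rewrite in_setE.
- by move=> a x y Nx Ny; rewrite -in_setE; apply: NL; rewrite in_setE.
- by rewrite in_setE.
- by move=> a x y; rewrite !in_setE; apply: NL.
Qed.

Lemma submodule0 N : submodule N -> N 0.
Proof. by case/submoduleP. Qed.

Lemma submoduleD N x y : submodule N -> N x -> N y -> N (x + y).
Proof. by move=> /submoduleP[_ NL] Nx Ny; rewrite -(scale1r x); apply: NL. Qed.

Lemma submoduleZ N a x : submodule N -> N x -> N (a *: x).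
Proof.
by move=> /submoduleP[N0 NL] Nx; rewrite -(addr0 (a *: x)); apply: NL.
Qed.

Lemma submoduleB N x y : submodule N -> N x -> N y -> N (x - y).
Proof.
by move=> sN Nx Ny; rewrite -scaleN1r; apply: submoduleD => //; apply: submoduleZ.
Qed.

Lemma submodule_line (x : M) : submodule (range (fun a : R => a *: x)).
Proof.
apply/submoduleP; split; first by exists 0 => //; rewrite scale0r.
by move=> c _ _ [a _ <-] [b _ <-]; exists (c * a + b) => //; rewrite scalerDl scalerA.
Qed.

Lemma module_colonE N I x : module_colon N I x <-> forall a, I a -> N (a *: x).
Proof.
split=> [NIx a Ia|NIx _ [a Ia <-]]; last exact: NIx.
by apply: NIx; exists a.
Qed.

Lemma sub_module_colon N I : submodule N -> N `<=` module_colon N I.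
Proof. by move=> sN x Nx; apply/module_colonE => a _; apply: submoduleZ. Qed.

Lemma submodule_colon N I : submodule N -> submodule (module_colon N I).
Proof.
move=> sN; apply/submoduleP; split.
  by apply: sub_module_colon => //; apply: submodule0.
move=> c x y /module_colonE NIx /module_colonE NIy; apply/module_colonE => a Ia.
rewrite scalerDr scalerA mulrC -scalerA.
by apply: submoduleD => //; [apply: submoduleZ => //; apply: NIx | apply: NIy].
Qed.

End Submodules.

Section IdealAction.
Variables (R : comNzRingType) (M : lmodType R).
Implicit Types (N K : set M) (I : set R).

Lemma ideal_annihilator_mod N x :
  submodule N -> ideal [set a : R | N (a *: x)].
Proof.
move=> sN; apply/(@submoduleP R R^o); split=> [|c a b Na Nb] /=.
  by rewrite scale0r; apply: submodule0.
rewrite -/(c * a) scalerDl -scalerA.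
by apply: submoduleD => //; apply: submoduleZ.
Qed.

(** Among the multiples [a ^+ i *: x], going up from [x] to one inside [N], some step must cross
    into [N]. The multiple just before that step is the one used to build witnesses. *)
Lemma last_power_outside N a n x :
    ~ N x -> N (a ^+ n *: x) ->
  exists2 j, ~ N (a ^+ j *: x) & N (a *: (a ^+ j *: x)).
Proof.
move=> Nx; elim: n => [|n IHn]; first by rewrite expr0 scale1r.
rewrite exprS -scalerA => Nan1.
by have [/IHn|Nan] := pselect (N (a ^+ n *: x)); last by exists n.
Qed.

(** Each generator of [I] has a power sending all of [M] into [N]. Treating generators one by one,
    the current element outside [N] is replaced by its last multiple outside [N] under powers of the
    new generator; the earlier generators still send it into [N] because scalars commute. *)
Lemma sub_module_colon_witness N K I :
    submodule N -> submodule K -> finitely_generated (I : set R^o) ->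
    I `<=` radical (ring_colon N) -> ~ K `<=` N ->
  exists x, [/\ K x, module_colon N I x & ~ N x].
Proof.
move=> sN sK [S /finite_seqP[s ->{S}] I_s] I_rad.
move=> /existsNP[y /not_implyP[Ky nNy]].
have sI : {subset s <= I}.
  by move=> a sa; rewrite in_setE I_s => J [_]; apply.
(* The scalars sending [x] into [N] form an ideal, so checking the generators suffices. *)
suff [x [Kx nNx Nsx]] :
    exists x, [/\ K x, ~ N x & forall a, a \in s -> N (a *: x)].
  exists x; split=> //; apply/module_colonE; rewrite I_s.
  apply: (smallest_sub (C := @submodule R R^o)) => //.
  exact: ideal_annihilator_mod.
(* A shorter list need not generate [I], so the induction keeps only the inclusion of [s] in [I]. *)
elim: s sI {I_s} => [|a s IHs] sI; first by exists y.
have [b sb|x [Kx nNx Nsx]] := IHs; first by apply: sI; rewrite inE sb orbT.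
have /I_rad[n _ Nan] : I a by rewrite -in_setE; apply/sI/mem_head.
have /(last_power_outside nNx)[j nNjx Najx] : N (a ^+ n *: x).
  by apply: Nan; exists x.
exists (a ^+ j *: x); split=> [||b] //; first exact: submoduleZ.
rewrite inE => /orP[/eqP-> //|sb].
by rewrite scalerA mulrC -scalerA; apply: submoduleZ => //; apply: Nsx.
Qed.

End IdealAction.

(** For a nonunit [a], Zorn's lemma gives an ideal maximal among the proper ideals containing [a].
    It is a maximal ideal, hence equal to [m], which would then contain [a]. *)
Lemma local_unit (R : comNzRingType) (m : set R) (a : R) :
  local_ring m -> ~ m a -> exists b, b * a = 1.
Proof.
move=> [_ m_uniq] nma; apply: contrapT => a_nonunit.
(* set0 is admitted because Zorn_bigcup also bounds the empty chain *)
pose P (J : set R) := J = set0 \/ [/\ ideal J, J a & ~ J 1].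
have [F F_P F_tot|A [[A0|[iA Aa nA1]] A_max]] := @Zorn_bigcup R P.
- have [[J FJ J_neq0]|F0] := pselect (exists2 J, F J & J <> set0); last first.
    left; rewrite -subset0 => x [J FJ Jx].
    by case: F0; exists J => // J0; rewrite J0 in Jx.
  have [//|[iJ Ja _]] := F_P _ FJ.
  have F_id J' x : F J' -> J' x -> [/\ ideal J', J' a & ~ J' 1].
    by move=> /F_P[-> //|].
  right; split; [|by exists J|by move=> [J' FJ' J'1]; have [_ _] := F_id _ _ FJ' J'1].
  apply/submoduleP; split; first by exists J => //; apply: (submodule0 iJ).
  move=> c x y [Jx FJx xJ] [Jy FJy yJ].
  have [iJx _ _] := F_id _ _ FJx xJ; have [iJy _ _] := F_id _ _ FJy yJ.
  have [xy|yx] := F_tot _ _ FJx FJy.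
  + by exists Jy => //; case/submoduleP: iJy => _; apply=> //; apply: xy.
  + by exists Jx => //; case/submoduleP: iJx => _; apply=> //; apply: yx.
(* The maximal element is not [set0]: the principal ideal of [a] is larger, and it is proper because
   [a] is a nonunit. *)
- have /A_max : A `<` range (fun b : R => b * a).
    by rewrite A0; split=> // /(_ a); apply; exists 1 => //; rewrite mul1r.
  apply; right; split; first exact: (@submodule_line R R^o).
    by exists 1 => //; rewrite mul1r.
  by move=> [b _ ba1]; apply: a_nonunit; exists b.
- apply: nma; rewrite -(m_uniq A) //; split=> // [AT|J iJ AJ].
    by apply: nA1; rewrite AT.
  have [J1|nJ1] := pselect (J 1).
    right; apply/seteqP; split=> // x _.
    by rewrite -(mulr1 x); apply: (submoduleZ x iJ).
  left; apply/seteqP; split=> //; apply: contrapT => nJA.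
  by apply: (A_max J) => //; right; split=> //; apply: AJ.
Qed.

Section StronglyIrreducible.
Variables (R : comNzRingType) (m : set R) (M : lmodType R) (N : set M).
Hypotheses (R_local : local_ring m) (N_sub : submodule N).
Hypothesis N_si : strongly_irreducible N.

Lemma module_colon_outside_line x y :
    module_colon N m x -> ~ N x -> module_colon N m y -> ~ N y ->
  exists a, y = a *: x.
Proof.
move=> Nmx nNx Nmy nNy.
have : ~ (range (fun a : R => a *: x) `&` range (fun a : R => a *: y)) `<=` N.
  move/(N_si (submodule_line x) (submodule_line y)) => [sub|sub].
    by apply/nNx/sub; exists 1 => //; rewrite scale1r.
  by apply/nNy/sub; exists 1 => //; rewrite scale1r.
move=> /existsNP[z /not_implyP[[[a _ axz] [b _ byz]] nNz]].
(* Inverting [b] in [a *: x = b *: y] expresses [y] through [x]; [b] is outside [m], since [m] sends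
   [y] into [N] but [b *: y] is outside [N]. *)
have [|c cb1] := @local_unit R m b R_local.
  by move=> mb; apply: nNz; rewrite -byz; move/module_colonE: Nmy; apply.
by exists (c * a); rewrite -scalerA axz -byz scalerA cb1 scale1r.
Qed.

Lemma module_colon_sub_generated K x :
    submodule K -> K x -> module_colon N m x -> ~ N x ->
  module_colon N m `<=` K.
Proof.
move=> sK Kx Nmx nNx.
have outside_sub y : module_colon N m y -> ~ N y -> K y.
  move=> Nmy nNy; have [a ->] := module_colon_outside_line Nmx nNx Nmy nNy.
  exact: submoduleZ.
move=> y Nmy; have [Ny|] := pselect (N y); last exact: outside_sub.
(* For [y] in [N], the translate [y + x] is outside [N], so it lies in [K] by the previous case, and
   so does its difference with [x]. *)
rewrite -(addrK x y); apply: submoduleB => //; apply: outside_sub.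
  exact: (submoduleD (submodule_colon m N_sub)) Nmy Nmx.
by move=> Nyx; apply: nNx; rewrite -(addKr y x) addrC; apply: submoduleB.
Qed.

End StronglyIrreducible.

Theorem theorem4p2 (R : comNzRingType) (m : set R)
    (R_noeth : noetherian_ring R) (R_local : local_ring m)
    (M : lmodType R) (M_fg : finitely_generated [set: M])
    (N : set M) (N_sub : submodule N) (N_si : strongly_irreducible N)
    (mM_neq_N : ideal_submod_mul m [set: M] <> N)
    (rad_N : radical (ring_colon N) = m) :
  [/\ forall K : set M, submodule K ->
        set_comparable N K /\ set_comparable (module_colon N m) K,
      N = \bigcup_(K in [set K : set M |
                          submodule K /\ K `<` module_colon N m]) K
    & module_colon N m =
        \bigcap_(L in [set L : set M | submodule L /\ N `<` L]) L].
Proof.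
have [[m_ideal m_proper _] _] := R_local.
have N_colon : N `<=` module_colon N m by apply: sub_module_colon.
have witness K : submodule K -> ~ K `<=` N ->
    exists x, [/\ K x, module_colon N m x & ~ N x].
  move=> sK; apply: sub_module_colon_witness => //; first exact: R_noeth.
  by rewrite rad_N.
(* No submodule escapes both alternatives; comparability and both formulas follow from this. *)
have dichotomy K : submodule K -> K `<=` N \/ module_colon N m `<=` K.
  move=> sK; have [|nKN] := pselect (K `<=` N); first by left.
  have [x [Kx Nmx nNx]] := witness K sK nKN.
  by right; apply: (module_colon_sub_generated R_local N_sub N_si sK Kx).
(* If [N] were all of [M], the radical [m] would contain 1. So [M] itself is not inside [N] and
   supplies a witness. *)
have N_proper : N `<` module_colon N m.
  split=> // colon_N; have [NT|] := pselect ([set: M] `<=` N).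
    apply: m_proper; apply/seteqP; split=> // a _; rewrite -rad_N.
    by exists 1%N => // y _; apply: NT.
  by move/witness => []; [apply/submoduleP|move=> x [_ /colon_N]].
split.
- move=> K /dichotomy[KN|colonK].
    by split; right=> //; apply: subset_trans N_colon.
  by split; left=> //; apply: subset_trans colonK.
(* By [N_proper], [N] is a member of the family; dually, the colon submodule is a member of the
   family intersected below. *)
- apply/seteqP; split=> [x Nx|x [K [sK [_ nK]] Kx]]; first by exists N.
  by have [KN|/nK] := dichotomy K sK => //; apply: KN.
- apply/seteqP; split=> [x Nmx L [sL [_ nL]]|x].
    by have [/nL|] := dichotomy L sL => //; apply.
  by apply; split=> //; apply: submodule_colon.
Qed.
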